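(* Let $N\ge0$ be an integer and let $a,b$ be real parameters that are generic, i.e. such that no denominator below vanishes. For all $m,n\in\{0,\dots,N\}$ the rational function $\mathcal U_m(n;a,b,N)$ of Hahn type obeys the recurrence relation $$(n-m-a)\,\mathcal A_m\big(\mathcal U_{m+1}(n;a,b,N)-\mathcal U_m(n;a,b,N)\big)+(n+m-a+b-N)\,\mathcal C_m\big(\mathcal U_{m-1}(n;a,b,N)-\mathcal U_m(n;a,b,N)\big)$$ $$=a(2m+b-N)\,\mathcal U_m(n;a,b,N),$$ where $$\mathcal A_m=\frac{(m+b+1)(m+b-N)}{2m+b-N+1},\qquad \mathcal C_m=\frac{m(m-N-1)}{2m+b-N-1}.$$
   Context: Rational functions of Hahn type: for $m=0,\dots,N$, $$\mathcal U_m(x;a,b,N)=\frac{(-1)^m(-N)_m}{(b+1)_m}\sum_{\ell=0}^m\frac{(-x)_\ell(-m)_\ell(b+m-N)_\ell}{\ell!\,(-N)_\ell(a-x)_\ell}$$ (the sum is ${}_3F_2(-x,-m,b+m-N;-N,a-x;1)$), where $(x)_0=1$, $(x)_k=x(x+1)\cdots(x+k-1)$. Conventions at the ends: $\mathcal U_{N+1}(n;a,b,N)=0$ for $n=0,\dots,N$ (consistent with the prefactor $(-N)_{N+1}=0$), and the term with $\mathcal C_0=0$ is omitted for $m=0$. *)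

(* Defs.v *)
From mathcomp Require Import all_boot all_order all_algebra.
From mathcomp Require Import reals.
Set Implicit Arguments.
Unset Strict Implicit.
Unset Printing Implicit Defensive.
Import Order.TTheory GRing.Theory Num.Theory.
Local Open Scope ring_scope.

(* (x)_k = x (x + 1) ... (x + k - 1) *)
Definition pochhammer (R : realType) (x : R) (k : nat) : R :=
  \prod_(i < k) (x + i%:R).

(* U_m(x; a, b, N): the explicit terminating 3F2 for m <= N, and 0 beyond
   (the only value used there is U_{N+1} = 0). *)
Definition hahnU (R : realType) (m : nat) (x a b : R) (N : nat) : R :=
  if (m <= N)%N then
    (-1) ^+ m * pochhammer (- N%:R) m / pochhammer (b + 1) m *
    \sum_(l < m.+1)
      (pochhammer (- x) l * pochhammer (- m%:R) l
         * pochhammer (b + m%:R - N%:R) l)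
      / ((l`!)%:R * pochhammer (- N%:R) l * pochhammer (a - x) l)
  else 0.

Definition hahnA (R : realType) (b : R) (N m : nat) : R :=
  (m%:R + b + 1) * (m%:R + b - N%:R) / (2 * m%:R + b - N%:R + 1).

Definition hahnC (R : realType) (b : R) (N m : nat) : R :=
  m%:R * (m%:R - N%:R - 1) / (2 * m%:R + b - N%:R - 1).

(* Non-vanishing of every denominator depending on a or b in U_m(n; a, b, N),
   A_m and C_m for 0 <= m, n <= N. The denominator of C_0 is not included,
   the C_m term being absent for m = 0; the denominators l! and (-N)_l,
   l <= N, never vanish. *)
Definition generic_params (R : realType) (a b : R) (N : nat) : Prop :=
  [/\ forall m : nat, (m <= N)%N -> pochhammer (b + 1) m != 0,
      forall n l : nat, (n <= N)%N -> (l <= N)%N ->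
        pochhammer (a - n%:R) l != 0,
      forall m : nat, (m <= N)%N -> 2 * m%:R + b - N%:R + 1 != 0
    & forall m : nat, (0 < m <= N)%N -> 2 * m%:R + b - N%:R - 1 != 0].

(* Main.v *)
(* The recurrence holds for the partial sums of the 3F2, up to a boundary term:
   weighting the l-th summands of U_{m+1}, U_m, U_{m-1} by the coefficients of
   the recurrence and summing over l <= L gives the closed form
   (2m + b - N) (L - x) T_L, where T_L is the L-th summand of U_m.  At L = N
   and x = n <= N this vanishes, since (-n)_N = 0 for n < N. *)
Require Import Defs.
From mathcomp Require Import all_boot all_order all_algebra.
From mathcomp Require Import reals.
From mathcomp Require Import ring.
Import Order.TTheory GRing.Theory Num.Theory.
Local Open Scope ring_scope.

Lemma pochhammer0 (R : realType) (x : R) : pochhammer x 0 = 1.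
Proof. by rewrite /pochhammer big_ord0. Qed.

Lemma pochhammerS (R : realType) (x : R) k :
  pochhammer x k.+1 = pochhammer x k * (x + k%:R).
Proof. by rewrite /pochhammer big_ord_recr. Qed.

Lemma pochhammerSl (R : realType) (x : R) k :
  pochhammer x k.+1 = x * pochhammer (x + 1) k.
Proof.
rewrite /pochhammer big_ord_recl addr0; congr (_ * _).
by apply: eq_bigr => i _; rewrite lift0 -natr1; ring.
Qed.

Lemma pochhammer_natN_eq0 (R : realType) (n k : nat) :
  (n < k)%N -> pochhammer (- n%:R : R) k = 0.
Proof.
by move=> nk; rewrite /pochhammer (bigD1 (Ordinal nk)) //= addNr mul0r.
Qed.

Lemma pochhammerS_neq0 (R : realType) (x : R) k :
  pochhammer x k.+1 != 0 -> x + k%:R != 0.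
Proof. by rewrite pochhammerS mulf_eq0 negb_or => /andP[]. Qed.

(* The l-th summand of U_mu(x; a, beta + nu, nu), with the degree mu and the
   size nu taken as real parameters. *)
Definition hahnT {R : realType} (x a beta nu mu : R) (l : nat) : R :=
  pochhammer (- x) l * pochhammer (- mu) l * pochhammer (beta + mu) l
  / ((l`!)%:R * pochhammer (- nu) l * pochhammer (a - x) l).

Lemma hahnT0 (R : realType) (x a beta nu mu : R) :
  hahnT x a beta nu mu 0 = 1.
Proof. by rewrite /hahnT !pochhammer0 fact0 !mulr1 divr1. Qed.

(** This lemma and the next two put the summands of index k + 1 in degrees mu, mu + 1 and mu - 1
    over the one value [T mu k], so that an induction on the upper summation bound reduces to a
    rational identity. *)
Lemma hahnTS (R : realType) (x a beta nu mu : R) k :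
  let T := hahnT x a beta nu in
  T mu k.+1 = T mu k * ((k%:R - x) * (k%:R - mu) * (beta + mu + k%:R)
                        / (k.+1%:R * (k%:R - nu) * (a - x + k%:R))).
Proof.
rewrite /= /hahnT !pochhammerS factS natrM !invfM.
by rewrite ![- _ + k%:R]addrC; ring.
Qed.

(** The factor [beta + mu] completes (beta + mu + 1)_(k+1) to (beta + mu)_(k+2), which contains
    (beta + mu)_k; no division by [beta + mu] is then needed. *)
Lemma hahnTS_succ (R : realType) (x a beta nu mu : R) k :
  let T := hahnT x a beta nu in
  (beta + mu) * T (mu + 1) k.+1 =
  T mu k * (- (mu + 1) * (k%:R - x) * (beta + mu + k%:R)
              * (beta + mu + k%:R + 1)
            / (k.+1%:R * (k%:R - nu) * (a - x + k%:R))).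
Proof.
move=> T; have pm : pochhammer (- (mu + 1)) k.+1 = - (mu + 1) * pochhammer (- mu) k.
  by rewrite pochhammerSl opprD addrNK.
have pb : (beta + mu) * pochhammer (beta + (mu + 1)) k.+1 =
    pochhammer (beta + mu) k * (beta + mu + k%:R) * (beta + mu + k%:R + 1).
  by rewrite addrA -pochhammerSl !pochhammerS -natr1; ring.
transitivity (pochhammer (- x) k.+1 * pochhammer (- (mu + 1)) k.+1
   * ((beta + mu) * pochhammer (beta + (mu + 1)) k.+1)
   / ((k.+1`!)%:R * pochhammer (- nu) k.+1 * pochhammer (a - x) k.+1)).
  by rewrite /T /hahnT; ring.
rewrite pm pb /T /hahnT.
by rewrite !pochhammerS factS natrM !invfM ![- _ + k%:R]addrC; ring.
Qed.

(** Here the factor [mu] plays the same part: mu (1 - mu)_(k+1) = - (- mu)_(k+2). *)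
Lemma hahnTS_pred (R : realType) (x a beta nu mu : R) k :
  let T := hahnT x a beta nu in
  mu * T (mu - 1) k.+1 =
  T mu k * (- (k%:R - x) * (k%:R - mu) * (k%:R + 1 - mu) * (beta + mu - 1)
            / (k.+1%:R * (k%:R - nu) * (a - x + k%:R))).
Proof.
move=> T; have pm : mu * pochhammer (- (mu - 1)) k.+1 =
    - (pochhammer (- mu) k * (k%:R - mu) * (k%:R + 1 - mu)).
  have -> : - (mu - 1) = - mu + 1 by ring.
  apply: oppr_inj; rewrite -mulNr -pochhammerSl !pochhammerS -natr1; ring.
have pb : pochhammer (beta + (mu - 1)) k.+1 =
    (beta + mu - 1) * pochhammer (beta + mu) k.
  by rewrite addrA pochhammerSl subrK.
transitivity (pochhammer (- x) k.+1 * (mu * pochhammer (- (mu - 1)) k.+1)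
   * pochhammer (beta + (mu - 1)) k.+1
   / ((k.+1`!)%:R * pochhammer (- nu) k.+1 * pochhammer (a - x) k.+1)).
  by rewrite /T /hahnT; ring.
rewrite pm pb /T /hahnT !pochhammerS factS natrM !invfM ![- _ + k%:R]addrC; ring.
Qed.

(* The hypothesis [mu != 0 -> _] allows the denominator of C_0 to vanish. *)
Lemma sum_hahnT_recurrence (R : realType) (x a beta nu mu : R) L :
  let T := hahnT x a beta nu in
  2 * mu + beta + 1 != 0 -> (mu != 0 -> 2 * mu + beta - 1 != 0) ->
  (forall k, (k < L)%N -> k%:R - nu != 0) ->
  (forall k, (k < L)%N -> a - x + k%:R != 0) ->
  \sum_(l < L.+1)
    ((x - mu - a) * (nu - mu) / (2 * mu + beta + 1)
       * ((beta + mu) * T (mu + 1) l)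
     - (x + mu - a + beta) * (beta + nu + mu) / (2 * mu + beta - 1)
       * (mu * T (mu - 1) l)
     - ((x - mu - a) * (mu + beta) * (mu + beta + nu + 1)
          / (2 * mu + beta + 1)
        + (x + mu - a + beta) * mu * (mu - nu - 1) / (2 * mu + beta - 1)
        + a * (2 * mu + beta)) * T mu l)
  = (2 * mu + beta) * (L%:R - x) * T mu L.
Proof.
move=> T d1 d2; elim: L => [|k IH] hnu ha.
  rewrite big_ord1 /= /T !hahnT0.
  (* Both terms over [2 * mu + beta - 1] carry a factor [mu]; for mu = 0 they are removed before
     [field] asks for that denominator to be nonzero. *)
  have [m0|mu0] := eqVneq mu 0; last by field; rewrite d1 d2.
  rewrite m0 !(mulr0, mul0r, add0r) in d1 *; by field.
rewrite big_ord_recr /= IH => [|j jk|j jk]; last 2 first.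
- by apply: hnu; exact: ltnW.
- by apply: ha; exact: ltnW.
rewrite /T hahnTS_succ (hahnTS _ _ _ _ _ mu).
have ek : k.+1%:R != 0 :> R by rewrite pnatr_eq0.
have nk := hnu k (ltnSn k).
have ak := ha k (ltnSn k).
rewrite -(natr1 k) in ek *.
have [m0|mu0] := eqVneq mu 0; last first.
  have d := d2 mu0; rewrite hahnTS_pred; field.
  by rewrite nk ak ek d1 d.
rewrite m0 !(mulr0, mul0r, add0r) in d1 *.
(* With the degree mu - 1 term gone, the identity at mu = 0 rests on k T_k = 0: either k = 0, or T_k
   = 0 because (0)_k = 0. *)
case: k {IH hnu ha} ek nk ak => [|k] ek nk ak.
  rewrite sub0r oppr_eq0 in nk; rewrite addr0 in ak.
  by rewrite hahnT0; field; rewrite d1 ak nk.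
have -> : hahnT x a beta nu 0 k.+1 = 0.
  by rewrite /hahnT (pochhammerSl R (- 0)) oppr0 !(mul0r, mulr0).
by rewrite !(mul0r, mulr0, subr0, addr0).
Qed.

Definition hahn_prefactor {R : realType} (b : R) (N m : nat) : R :=
  (-1) ^+ m * pochhammer (- N%:R) m / pochhammer (b + 1) m.

(** This ratio cancels m + b + 1 in A_m and, one degree lower, m - N - 1 in C_m up to sign; what
    remains are the coefficients in [sum_hahnT_recurrence]. *)
Lemma hahn_prefactorS (R : realType) (b : R) N m :
  hahn_prefactor b N m.+1 =
  hahn_prefactor b N m * ((N%:R - m%:R) / (m%:R + b + 1)).
Proof.
have -> : m%:R + b + 1 = b + 1 + m%:R by ring.
by rewrite /hahn_prefactor !pochhammerS exprS !invfM; ring.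
Qed.

(** Since (-m)_l = 0 for l > m, the sum may run up to N, a range common to the neighbouring
    degrees. *)
Lemma hahnU_sum (R : realType) (x a b : R) N m : (m <= N)%N ->
  hahnU m x a b N = hahn_prefactor b N m *
    \sum_(l < N.+1) hahnT x a (b - N%:R) N%:R m%:R l.
Proof.
move=> mN; rewrite /hahnU mN; congr (_ * _).
transitivity (\sum_(l < m.+1) hahnT x a (b - N%:R) N%:R m%:R l).
  by apply: eq_bigr => l _; rewrite /hahnT addrAC.
rewrite (big_ord_widen N.+1 (hahnT x a (b - N%:R) N%:R m%:R)) ?ltnS //.
rewrite [LHS]big_mkcond; apply: eq_bigr => l _; case: ltnP => // ml.
by rewrite /hahnT (pochhammer_natN_eq0 R m) // mulr0 !mul0r.
Qed.

Theorem proposition6 (R : realType) (N : nat) (a b : R)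
    (hgen : generic_params a b N) (m n : nat)
    (hm : (m <= N)%N) (hn : (n <= N)%N) :
  (n%:R - m%:R - a) * hahnA b N m
    * (hahnU m.+1 n%:R a b N - hahnU m n%:R a b N)
  + (if m is m'.+1 then
       (n%:R + m%:R - a + b - N%:R) * hahnC b N m
         * (hahnU m' n%:R a b N - hahnU m n%:R a b N)
     else 0)
  = a * (2 * m%:R + b - N%:R) * hahnU m n%:R a b N.
Proof.
case: hgen => hb ha hd1 hd2.
pose S mu := \sum_(l < N.+1) hahnT n%:R a (b - N%:R) N%:R mu l.
pose c := hahn_prefactor b N m.
have Um k : (k <= N)%N -> hahnU k n%:R a b N = hahn_prefactor b N k * S k%:R.
  exact: hahnU_sum.
have USm : hahnA b N m * hahnU m.+1 n%:R a b N
    = c * ((N%:R - m%:R) * (m%:R + b - N%:R) / (2 * m%:R + b - N%:R + 1))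
      * S (m%:R + 1).
  have [mN|] := ltnP m N.
    have bm := pochhammerS_neq0 _ _ _ (hb _ mN).
    rewrite Um // hahn_prefactorS natr1 /hahnA -/c; field.
    by rewrite hd1 // (_ : _ + _ = b + 1 + m%:R) ?bm //; ring.
  (* Remaining case m = N: the left side is 0 by the convention U_(N+1) = 0, the right side by its
     factor N - m, whatever the value of [S (m%:R + 1)]. *)
  rewrite leq_eqVlt ltnNge hm orbF => /eqP NM.
  by rewrite /hahnU NM ltnn subrr !(mulr0, mul0r).
have e1 : 2 * m%:R + b - N%:R + 1 = 2 * m%:R + (b - N%:R) + 1 by ring.
have e2 : 2 * m%:R + b - N%:R - 1 = 2 * m%:R + (b - N%:R) - 1 by ring.
have rec : (n%:R - m%:R - a) * (N%:R - m%:R) / (2 * m%:R + b - N%:R + 1)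
       * ((b - N%:R + m%:R) * S (m%:R + 1))
     - (n%:R + m%:R - a + b - N%:R) * (b + m%:R) / (2 * m%:R + b - N%:R - 1)
       * (m%:R * S (m%:R - 1))
     - ((n%:R - m%:R - a) * (m%:R + b - N%:R) * (m%:R + b + 1)
          / (2 * m%:R + b - N%:R + 1)
        + (n%:R + m%:R - a + b - N%:R) * m%:R * (m%:R - N%:R - 1)
          / (2 * m%:R + b - N%:R - 1)
        + a * (2 * m%:R + b - N%:R)) * S m%:R = 0.
  rewrite /S !mulr_sumr -!sumrB.
  transitivity ((2 * m%:R + (b - N%:R)) * (N%:R - n%:R)
                * hahnT n%:R a (b - N%:R) N%:R m%:R N).
    rewrite -sum_hahnT_recurrence.
    - by apply: eq_bigr => l _; rewrite e1 e2; ring.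
    - by rewrite -e1 hd1.
    - move=> m0; rewrite -e2 hd2 // hm andbT lt0n.
      by apply: contraNneq m0 => ->.
    - by move=> k kN; rewrite subr_eq0 eqr_nat ltn_eqF.
    - by move=> k kN; apply: pochhammerS_neq0; exact: ha.
  move: hn; rewrite leq_eqVlt => /predU1P[->|nN].
    by rewrite subrr mulr0 mul0r.
  by rewrite /hahnT (pochhammer_natN_eq0 R n) // !(mul0r, mulr0).
apply/eqP; rewrite -subr_eq0 -(mulrA _ (hahnA b N m)) (mulrBr (hahnA b N m)) USm Um // -/c; apply/eqP.
(* The zero on the right becomes c times the left side of [rec], leaving only ring identities once
   the prefactors are aligned. *)
rewrite -[RHS](mulr0 c) -[in RHS]rec /hahnA.
(* For m = 0 the terms of [rec] that stem from C_0 have the factor m = 0, matching the omitted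
   term. *)
case: m => [|m'] in hm c USm e1 e2 rec *; first by ring.
have USp : hahnC b N m'.+1 * hahnU m' n%:R a b N
    = - c * (m'.+1%:R * (b + m'.+1%:R) / (2 * m'.+1%:R + b - N%:R - 1))
      * S (m'.+1%:R - 1).
  have bm := pochhammerS_neq0 _ _ _ (hb _ hm).
  have d2 := hd2 m'.+1 hm.
  rewrite Um 1?ltnW // /c hahn_prefactorS -[in S (_ - 1)]natr1 addrK /hahnC.
  rewrite -(natr1 m') in d2 *; field; rewrite d2 /=.
  by rewrite (_ : _ + _ = b + 1 + m'%:R) ?bm //; ring.
rewrite -(mulrA _ (hahnC _ _ _)) (mulrBr (hahnC _ _ _)) USp /hahnC; ring.
Qed.
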